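(* Let $\mathsf{H}$ be a (real or complex) Hilbert space, let $u_1,\dots,u_N\in\mathsf{H}$ be finitely many vectors and let $\lambda_1,\dots,\lambda_N\in\mathbb{R}$ be scalars. Define the $N\times N$ matrices $Q$ and $\Lambda$ by $$Q_{mn}=\langle u_m|u_n\rangle,\qquad \Lambda_{mn}=\lambda_n\delta_{mn}.$$ Let $S$ be any matrix (with $N$ columns, finitely many rows, and entries in the scalar field of $\mathsf{H}$) such that $Q=S^{\ast}S$, and define the self-adjoint matrix $P=S\Lambda S^{\ast}$. Then $$\sup\Big\{\sum_{n=1}^N\lambda_n\langle u_n|\mathsf{E}|u_n\rangle : \mathsf{E}\in\mathcal{B}[\mathsf{H}],\ \mathsf{E}^{\ast}=\mathsf{E},\ \mathsf{E}^2=\mathsf{E}\Big\}$$ is equal to the sum of the positive eigenvalues of $P$, counted with multiplicity.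
   Context: $\mathcal{B}[\mathsf{H}]$ denotes the bounded linear operators on $\mathsf{H}$. The inner product $\langle\cdot|\cdot\rangle$ is linear in its second argument (and conjugate-linear in the first), and $\langle u|\mathsf{E}|u\rangle=\langle u|\mathsf{E}u\rangle$. A projection means an orthogonal projection, i.e. a self-adjoint idempotent bounded operator. $S^{\ast}$ is the conjugate transpose of $S$. The matrix $Q$ is positive semi-definite, so decompositions $Q=S^{\ast}S$ exist. An empty sum of eigenvalues is $0$. *)

(* Defs.v *)
From HB Require Import structures.
From mathcomp Require Import all_boot all_order all_algebra.
From mathcomp Require Import all_classical all_reals all_analysis.
From mathcomp Require Import complex.
Set Implicit Arguments.
Unset Strict Implicit.
Unset Printing Implicit Defensive.
Import Order.TTheory GRing.Theory Num.Theory.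
Import numFieldNormedType.Exports.
Local Open Scope classical_set_scope.
Local Open Scope ring_scope.

Inductive scalar_kind := RealScalars | ComplexScalars.

Definition scalar_field (R : realType) (k : scalar_kind) : numFieldType :=
  match k with
  | RealScalars => R
  | ComplexScalars => R[i]
  end.

Definition scalar_of_real (R : realType) (k : scalar_kind) :
    R -> scalar_field R k :=
  match k with
  | RealScalars => fun x => x
  | ComplexScalars => fun x => x%:C%C
  end.

Definition scalar_re (R : realType) (k : scalar_kind) : scalar_field R k -> R :=
  match k with
  | RealScalars => fun z => z
  | ComplexScalars => fun z => complex.Re z
  end.

Definition scalar_conj (R : realType) (k : scalar_kind) :
    scalar_field R k -> scalar_field R k :=
  match k with
  | RealScalars => fun z => z
  | ComplexScalars => fun z => conjc z
  end.

(* The norm of a normed module over K takes its values in K, so that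
   [inner_norm] says <u|u> = ||u||^2 in K; positive definiteness of the inner
   product follows from the axioms of the norm, and completeness is that of
   [completeNormedModType]. *)
HB.mixin Record CompleteNormedModule_isHilbert (R : realType)
    (k : scalar_kind) H & CompleteNormedModule (scalar_field R k) H := {
  inner : H -> H -> scalar_field R k;
  innerC : forall u v : H, inner u v = scalar_conj (inner v u);
  innerDr : forall u v w : H, inner u (v + w) = inner u v + inner u w;
  innerZr : forall (a : scalar_field R k) (u v : H),
    inner u (a *: v) = a * inner u v;
  inner_norm : forall u : H, inner u u = `|u| ^+ 2
}.

#[short(type="hilbertType")]
HB.structure Definition Hilbert (R : realType) (k : scalar_kind) :=
  { H of CompleteNormedModule (scalar_field R k) H
       & CompleteNormedModule_isHilbert R k H }.

Section Operators.
Context (R : realType) (k : scalar_kind) (H : hilbertType R k).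
Implicit Type E : {linear H -> H}.

Definition bounded_op E : Prop :=
  exists M : scalar_field R k, forall v : H, `|E v| <= M * `|v|.

Definition self_adjoint E : Prop :=
  forall u v : H, inner (E u) v = inner u (E v).

Definition orth_projection E : Prop :=
  [/\ bounded_op E, self_adjoint E & forall v : H, E (E v) = E v].

Definition gram N (u : 'I_N -> H) : 'M[scalar_field R k]_N :=
  \matrix_(m, n) inner (u m) (u n).

End Operators.

Section Matrices.
Context (R : realType) (k : scalar_kind).

Definition ctranspose (m n : nat) (A : 'M[scalar_field R k]_(m, n)) :
    'M[scalar_field R k]_(n, m) := map_mx (@scalar_conj R k) A^T.

Definition real_diag N (lam : 'I_N -> R) : 'M[scalar_field R k]_N :=
  diag_mx (\row_n scalar_of_real k (lam n)).

(* The multiplicity of an eigenvalue is the dimension of its eigenspace; for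
   a self-adjoint matrix this is also its multiplicity as a root of the
   characteristic polynomial. [eigenspace] consists of row vectors, and has the
   same dimension as the space of column eigenvectors. Only finitely
   many [a] are eigenvalues, so this sum over a set of reals has finite
   support. *)
Definition sum_pos_eigenvalues m (A : 'M[scalar_field R k]_m) : R :=
  \sum_(a \in [set a : R | 0 < a /\ eigenvalue A (scalar_of_real k a)])
    a *+ \rank (eigenspace A (scalar_of_real k a)).

End Matrices.

(* Main.v *)
From HB Require Import structures.
Require Import Defs.
From mathcomp Require Import all_boot all_order all_algebra.
From mathcomp Require Import all_classical all_reals all_analysis.
From mathcomp Require Import complex sesquilinear spectral.
Set Implicit Arguments.
Unset Strict Implicit.
Unset Printing Implicit Defensive.
Import Order.TTheory GRing.Theory Num.Theory.
Import numFieldNormedType.Exports.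
Local Open Scope classical_set_scope.
Local Open Scope ring_scope.

(* Let [T] send the scalars [c_n] to [\sum_n c_n u_n].  Since
   [T^* T = Q = S^* S], [T] factors as [T = W S] with [W] isometric on the range
   of [S], so the weighted sum at [E] is the trace of [E W P W^*].
   Diagonalising [P = \sum_i d_i v_i v_i^*] and putting [w_i = W v_i], it is
   [\sum_i d_i <w_i|E w_i>], where the [w_i] with [d_i != 0] are orthonormal
   because the corresponding [v_i] lie in the range of [S].  Each [<w_i|E w_i>]
   lies in [0, 1], and the bound is attained by the projection onto the span of
   the [w_i] with [d_i > 0]. *)

(** * Conjugation, real embedding and real part for both scalar fields *)

Section Scalars.
Context (R : realType) (k : scalar_kind).
Local Notation K := (scalar_field R k).

Fact scalar_conj_is_zmod_morphism : zmod_morphism (@scalar_conj R k).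
Proof. by case: k => x y //=; rewrite rmorphB. Qed.

Fact scalar_conj_is_monoid_morphism : monoid_morphism (@scalar_conj R k).
Proof. by case: k; split=> //=; [exact: conjc1 | exact: rmorphM]. Qed.

HB.instance Definition _ :=
  GRing.isZmodMorphism.Build K K (@scalar_conj R k)
    scalar_conj_is_zmod_morphism.
HB.instance Definition _ :=
  GRing.isMonoidMorphism.Build K K (@scalar_conj R k)
    scalar_conj_is_monoid_morphism.

Fact scalar_of_real_is_zmod_morphism : zmod_morphism (@scalar_of_real R k).
Proof. by case: k => x y //=; rewrite rmorphB. Qed.

Fact scalar_of_real_is_monoid_morphism : monoid_morphism (@scalar_of_real R k).
Proof. by case: k; split=> //=; exact: rmorphM. Qed.

HB.instance Definition _ :=
  GRing.isZmodMorphism.Build R K (@scalar_of_real R k)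
    scalar_of_real_is_zmod_morphism.
HB.instance Definition _ :=
  GRing.isMonoidMorphism.Build R K (@scalar_of_real R k)
    scalar_of_real_is_monoid_morphism.

Fact scalar_re_is_zmod_morphism : zmod_morphism (@scalar_re R k).
Proof. by case: k => x y //=; rewrite raddfB. Qed.

HB.instance Definition _ :=
  GRing.isZmodMorphism.Build K R (@scalar_re R k) scalar_re_is_zmod_morphism.

Lemma scalar_conjK : involutive (@scalar_conj R k).
Proof. by case: k => //=; exact: conjcK. Qed.

Lemma scalar_conj_real (x : R) :
  scalar_conj (scalar_of_real k x) = scalar_of_real k x.
Proof. by case: k => //=; rewrite oppr0. Qed.

Lemma scalar_re_realM (x : R) (z : K) :
  scalar_re (scalar_of_real k x * z) = x * scalar_re z.
Proof. by case: k z => //= -[a b] /=; rewrite mul0r subr0. Qed.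

Lemma le_scalar_re (y z : K) : y <= z -> scalar_re y <= scalar_re z.
Proof. by case: k y z => //= -[a b] [c d]; rewrite lecE => /andP[]. Qed.

Lemma scalar_re1 : scalar_re (1 : K) = 1.
Proof. by case: k. Qed.

End Scalars.

(** * Algebra of the conjugate transpose *)

Section ConjugateTranspose.
Context (R : realType) (k : scalar_kind).
Local Notation K := (scalar_field R k).

Lemma ctransposeK m n (A : 'M[K]_(m, n)) : ctranspose (ctranspose A) = A.
Proof. by apply/matrixP=> i j; rewrite !mxE scalar_conjK. Qed.

Lemma ctranspose_mul m n p (A : 'M[K]_(m, n)) (B : 'M[K]_(n, p)) :
  ctranspose (A *m B) = ctranspose B *m ctranspose A.
Proof. by rewrite /ctranspose trmx_mul map_mxM. Qed.

Lemma ctranspose_real_diag n (d : 'I_n -> R) :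
  ctranspose (real_diag k d) = real_diag k d.
Proof.
rewrite /ctranspose tr_diag_mx map_diag_mx.
congr diag_mx; apply/rowP => i; rewrite !mxE.
exact: scalar_conj_real.
Qed.

End ConjugateTranspose.

(** * Spectral theorem for self-adjoint matrices over either field *)

Section SpectralTheorem.
Context (R : realType).

Lemma complex_spectral n (A : 'M[scalar_field R ComplexScalars]_n) :
  ctranspose A = A ->
  exists (U : 'M[scalar_field R ComplexScalars]_n) (d : 'I_n -> R),
    U *m ctranspose U = 1%:M /\
    A = ctranspose U *m real_diag ComplexScalars d *m U.
Proof.
move=> A_sa; have A_herm : (A : 'M[R[i]]_n) \is hermsymmx.
  by apply/is_hermitianmxP; rewrite expr0 scale1r -[LHS]A_sa.
have sp_real := hermitian_spectral_diag_real A_herm.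
have /orthomx_spectralP A_eq := hermitian_normalmx A_herm.
have U_unitary := spectral_unitarymx (A : 'M[R[i]]_n).
rewrite (invmx_unitary U_unitary) in A_eq.
exists (spectralmx (A : 'M[R[i]]_n)).
exists (fun i => complex.Re (spectral_diag (A : 'M[R[i]]_n) 0 i)); split.
  exact/unitarymxP.
rewrite {1}A_eq; congr (_ *m diag_mx _ *m _); apply/rowP => i; rewrite !mxE /=.
exact/esym/RRe_real/(mxOverP sp_real).
Qed.

Lemma row_sqnorm_gt0 n (v : 'rV[R]_n) : v != 0 -> 0 < (v *m v^T) 0 0.
Proof.
move=> v_neq0; have [i vi] : exists i, v 0 i != 0.
  apply/existsP; apply: contraNT v_neq0 => /existsPn v0.
  by apply/eqP/rowP => i; rewrite mxE; apply/eqP; rewrite -[_ == _]negbK v0.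
rewrite mxE (bigD1 i) //= mxE -expr2 ltr_pwDl ?exprn_even_gt0 //.
by apply: sumr_ge0 => j _; rewrite mxE -expr2 sqr_ge0.
Qed.

(** The complex spectral theorem gives [A], read over [R[i]], an eigenvalue that is real. Being an
    eigenvalue does not depend on the field extension, so a real eigenvector exists, and it is then
    normalised. *)
Lemma symmetric_eigenvector n (A : 'M[R]_n.+1) : A^T = A ->
  exists a (v : 'rV[R]_n.+1), v *m A = a *: v /\ v *m v^T = 1%:M.
Proof.
move=> A_sym; have [] := @complex_spectral _ (map_mx (real_complex R) A).
  rewrite /ctranspose map_trmx A_sym; apply/matrixP => i j; rewrite !mxE.
  exact: conjc_real.
move=> U [d [UU A_eq]].
have : eigenvalue (map_mx (real_complex R) A) (real_complex R (d 0)).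
  apply/eigenvalueP; exists (row 0 U).
    rewrite A_eq -row_mul !mulmxA UU mul1mx mul_diag_mx.
    by apply/rowP => j; rewrite !mxE.
  apply/eqP => U0; have /matrixP/(_ 0 0) := congr1 (row 0) UU.
  by rewrite row_mul U0 mul0mx !mxE => /eqP; rewrite eq_sym oner_eq0.
rewrite eigenvalue_map => /eigenvalueP[v vA /row_sqnorm_gt0].
have := mx11_scalar (v *m v^T); set c := _ 0 0 => vv c_gt0.
exists (d 0), ((Num.sqrt c)^-1 *: v); split.
  by rewrite -scalemxAl vA !scalerA mulrC.
rewrite linearZ /= -scalemxAl -scalemxAr vv scalerA -invfM -expr2.
by rewrite sqr_sqrtr ?ltW // scale_scalar_mx mulVf ?gt_eqF.
Qed.

(* The Householder reflection along [delta_mx 0 0 - v]. *)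
Lemma reflection_to_first n (v : 'rV[R]_n.+1) : v *m v^T = 1%:M ->
  exists Q : 'M[R]_n.+1, [/\ Q^T = Q, Q *m Q = 1%:M & delta_mx 0 0 *m Q = v].
Proof.
move=> vv; pose e : 'rV[R]_n.+1 := delta_mx 0 0; pose w := e - v.
have [w0|/row_sqnorm_gt0] := eqVneq w 0.
  exists 1%:M; rewrite trmx1 !mulmx1; split=> //.
  by apply/eqP; rewrite -subr_eq0 -/w w0.
have := mx11_scalar (w *m w^T); set c := _ 0 0 => ww c_gt0.
(* As [e] and [v] are unit vectors, [w w^T = 2 - 2 e v^T = 2 e w^T]; this is what makes the
   reflection carry [e] to [v]. *)
have ew : e *m w^T = (c / 2)%:M.
  have ee : e *m e^T = 1%:M.
    rewrite trmx_delta mul_delta_mx; apply/matrixP => i j.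
    by rewrite !ord1 !mxE.
  have ve : v *m e^T = e *m v^T.
    by rewrite [LHS]mx11_scalar -tr_scalar_mx -mx11_scalar trmx_mul trmxK.
  have : w *m w^T = 2 *: (e *m w^T).
    have vw : v *m w^T = - (e *m w^T).
      by rewrite /w linearB /= !mulmxBr ee vv ve opprB.
    by rewrite {1}/w mulmxBl vw opprK -mulr2n scaler_nat.
  rewrite ww => /(congr1 ( *:%R (2^-1))).
  by rewrite scalerA mulVf // scale1r scale_scalar_mx mulrC => <-.
exists (1%:M - (2 / c) *: (w^T *m w)); split.
- by rewrite linearB /= trmx1 linearZ /= trmx_mul trmxK.
- rewrite mulmxBr mulmx1 mulmxBl mul1mx -scalemxAl -scalemxAr scalerA.
  rewrite mulmxA -(mulmxA w^T) ww mul_mx_scalar -scalemxAl scalerA.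
  have -> : 2 / c * (2 / c) * c = 2 / c + 2 / c.
    by rewrite -mulrA divfK ?gt_eqF // mulr_natr mulr2n.
  by rewrite scalerDl opprB addrK subrK.
- rewrite mulmxBr mulmx1 -scalemxAr mulmxA ew mul_scalar_mx scalerA.
  by rewrite mulrA divfK ?gt_eqF // divff // scale1r opprB addrC subrK.
Qed.

(** Deflation by induction on the size: the reflection [Q] exchanges a unit eigenvector with the
    first basis vector, so [Q A Q] splits into a 1 by 1 block and a smaller symmetric block. *)
Lemma symmetric_spectral n (A : 'M[R]_n) : A^T = A ->
  exists (U : 'M[R]_n) (d : 'rV[R]_n),
    U *m U^T = 1%:M /\ A = U^T *m diag_mx d *m U.
Proof.
elim: n => [|n IHn] in A *.
  by exists 0, 0; split; apply/matrixP => -[].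
move=> A_sym; have [a [v [vA /reflection_to_first[Q [Q_sym QQ eQ]]]]] :=
  symmetric_eigenvector A_sym.
(* [B] is made opaque and given size [1 + n], the form expected by the block decomposition. *)
have [B BE] : exists B : 'M[R]_(1 + n), B = Q *m A *m Q by exists (Q *m A *m Q).
have B_sym : B^T = B by rewrite BE !trmx_mul Q_sym A_sym mulmxA.
have B0 : row 0 B = a *: delta_mx 0 0.
  by rewrite BE !row_mul rowE eQ vA -scalemxAl -eQ -mulmxA QQ mulmx1.
have Bur : ursubmx B = 0.
  apply/matrixP => i j; rewrite ord1 !mxE.
  have /rowP/(_ (rshift 1 j)) := B0; rewrite !mxE mulr0 => <-.
  by congr (B _ _); exact: val_inj.
have Bdl : dlsubmx B = 0.
  by rewrite -B_sym -trmx_ursub Bur trmx0.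
have [|U' [d [UU B_eq]]] := IHn (drsubmx B).
  by rewrite trmx_drsub B_sym.
pose V : 'M[R]_(1 + n) := block_mx 1%:M 0 0 U'.
have VV : V *m V^T = 1%:M.
  rewrite tr_block_mx mulmx_block !trmx0 trmx1 !mulmx0 !mul0mx !addr0 !add0r.
  by rewrite mulmx1 UU -scalar_mx_block.
have B_V : B = V^T *m diag_mx (row_mx (ulsubmx B) d) *m V.
  rewrite diag_mx_row tr_block_mx !mulmx_block !trmx0 trmx1.
  rewrite !(mulmx0, mul0mx, addr0, add0r, mul1mx, mulmx1) -B_eq.
  rewrite -{1}[B]submxK Bur Bdl; congr block_mx.
  by apply/matrixP => i j; rewrite !ord1 !mxE mulr1n.
exists (V *m Q), (row_mx (ulsubmx B) d); split.
  by rewrite trmx_mul Q_sym mulmxA -(mulmxA V) QQ mulmx1.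
rewrite trmx_mul Q_sym !mulmxA -2!(mulmxA Q) -B_V.
by rewrite BE !mulmxA QQ mul1mx -mulmxA QQ mulmx1.
Qed.

End SpectralTheorem.

Lemma spectral_theorem (R : realType) (k : scalar_kind) n
    (A : 'M[scalar_field R k]_n) :
  ctranspose A = A -> exists (U : 'M[scalar_field R k]_n) (d : 'I_n -> R),
    U *m ctranspose U = 1%:M /\ A = ctranspose U *m real_diag k d *m U.
Proof.
case: k A => A A_sa; last exact: complex_spectral.
have [|U [d [UU A_eq]]] := @symmetric_spectral R _ A.
  by rewrite -[RHS]A_sa [RHS]map_mx_id.
exists U, (fun i => d 0 i); rewrite /ctranspose map_mx_id //; split=> //.
by rewrite [LHS]A_eq; congr (_ *m diag_mx _ *m _); apply/rowP => i; rewrite mxE.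
Qed.

(** * Eigenspace dimensions and the sum of the positive eigenvalues *)

Section Eigenvalues.
Local Open Scope nat_scope.

Lemma rank_diag_mx (F : fieldType) n (d : 'rV[F]_n) :
  \rank (diag_mx d) = \sum_(i < n) (d ord0 i != 0%R).
Proof.
elim: n d => [|n IHn] d; first by rewrite big_ord0 flatmx0 mxrank0.
pose l : 'rV[F]_1 := @lsubmx _ 1 1 n d; pose r := @rsubmx _ 1 1 n d.
have -> : \rank (diag_mx d) =
    \rank (block_mx (diag_mx l) 0%R 0%R (diag_mx r)).
  by rewrite -diag_mx_row hsubmxK.
rewrite rank_diag_block_mx IHn (@big_split_ord _ _ _ 1 n) /= big_ord1.
congr (_ + _); last by apply: eq_bigr => i _; rewrite mxE.
have -> : diag_mx l = l by apply/matrixP => i j; rewrite !ord1 !mxE.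
rewrite rank_rV; congr (nat_of_bool (~~ _)).
apply/eqP/eqP => [/rowP/(_ ord0)|d0]; first by rewrite !mxE.
by apply/rowP => i; rewrite ord1 !mxE.
Qed.

(** Since [V U = 1], subtracting [a] only shifts the diagonal: the eigenspace is the kernel of
    [V diag(d - a) U], whose rank counts the [i] with [d i != a]. *)
Lemma rank_eigenspace_diag (F : fieldType) n (U V : 'M[F]_n) (d : 'rV[F]_n) a :
  (U *m V = 1%:M)%R ->
  \rank (eigenspace (V *m diag_mx d *m U)%R a) = \sum_(i < n) (d ord0 i == a).
Proof.
move=> UV; have /mulmx1_unit[U_unit V_unit] := UV.
have VU : (V *m U = 1%:M)%R by exact: mulmx1C.
have -> : eigenspace (V *m diag_mx d *m U)%R a =
    kermx (V *m diag_mx (d - const_mx a)%R *m U)%R.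
  rewrite linearB /= mulmxBr mulmxBl diag_const_mx mul_mx_scalar -scalemxAl VU.
  by rewrite scalemx1.
rewrite mxrank_ker mxrankMfree ?row_free_unit // -mxrank_tr trmx_mul.
rewrite mxrankMfree ?row_free_unit ?unitmx_tr // mxrank_tr rank_diag_mx.
rewrite -[X in X - _]card_ord -sum1_card -sumnB //; last first.
  by move=> i _; case: eqP.
by apply: eq_bigr => i _; rewrite !mxE subr_eq0; case: eqP.
Qed.

End Eigenvalues.

Lemma sum_pos_eigenvalues_diag (R : realType) (k : scalar_kind) n
    (U : 'M[scalar_field R k]_n) (d : 'I_n -> R) :
  U *m ctranspose U = 1%:M ->
  sum_pos_eigenvalues (ctranspose U *m real_diag k d *m U) =
  \sum_(i < n | 0 < d i) d i.
Proof.
move=> UU; set A := _ *m U.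
have rankE a : \rank (eigenspace A (scalar_of_real k a)) =
    (\sum_(i < n) (d i == a))%N.
  rewrite rank_eigenspace_diag //; apply: eq_bigr => i _; rewrite mxE.
  by rewrite (inj_eq (fmorph_inj _)).
have eigenvalueE a :
    eigenvalue A (scalar_of_real k a) = (a \in codom d).
  rewrite /eigenvalue -mxrank_eq0 rankE sum_nat_eq0.
  apply/forallPn/codomP => [[i0]|[i ->]]; last by exists i; rewrite eqxx.
  by rewrite eqb0 negbK => /eqP <-; exists i0.
(* This list enumerates the positive eigenvalues once each. After the exchange of sums below, an
   index [i] meets only the term [a = d i]. *)
pose r := undup [seq d i | i in [pred i | 0 < d i]].
have mem_r a : (a \in r) = (0 < a) && eigenvalue A (scalar_of_real k a).
  rewrite mem_undup eigenvalueE; apply/fintype.imageP/andP => [[i di_gt0 ->]|].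
    by split=> //; exact: codom_f.
  by move=> [a_gt0 /codomP[i aE]]; exists i; rewrite // inE -aE.
rewrite /sum_pos_eigenvalues (fsbigE r) ?undup_uniq //; last 2 first.
- by move=> a /=; rewrite mem_r => /andP.
- by move=> a [a_gt0 a_eig]; rewrite mem_r a_gt0 a_eig.
rewrite big_seq_cond (eq_bigl (mem r)) => [|a]; last first.
  rewrite andb_idr // mem_r => /andP a_pos_eig; exact: mem_set.
rewrite -big_seq; under eq_bigr do rewrite rankE -sumrMnr.
rewrite exchange_big [RHS]big_mkcond; apply: eq_bigr => i _ /=.
case: ifPn => [di_gt0|di_le0].
  have di_r : d i \in r by rewrite mem_undup; apply/fintype.imageP; exists i.
  rewrite (bigD1_seq (d i)) ?undup_uniq //= eqxx mulr1n big1 ?addr0 // => a.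
  by rewrite eq_sym => /negPf ->.
rewrite big_seq big1 // => a; rewrite mem_r => /andP[a_gt0 _].
by case: eqP => // diE; rewrite diE a_gt0 in di_le0.
Qed.

(** * Inner products and orthogonal projections *)

Section InnerProduct.
Context (R : realType) (k : scalar_kind) (H : hilbertType R k).
Local Notation K := (scalar_field R k).
Implicit Types (x y z : H) (a : K).

Fact inner_is_semilinear x : semilinear_for *%R (@inner R k H x).
Proof. by split=> [a y|y z]; [exact: innerZr | exact: innerDr]. Qed.

HB.instance Definition _ x :=
  GRing.isSemilinear.Build K H K *%R (@inner R k H x) (inner_is_semilinear x).

Lemma conj_inner x y : scalar_conj (inner x y) = inner y x.
Proof. by rewrite -(innerC y x). Qed.

Lemma innerDl x y z : inner (x + y) z = inner x z + inner y z.
Proof. by rewrite innerC innerDr rmorphD /= !conj_inner. Qed.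

Lemma innerZl a x y : inner (a *: x) y = scalar_conj a * inner x y.
Proof. by rewrite innerC innerZr rmorphM /= conj_inner. Qed.

Lemma innerBl x y z : inner (x - y) z = inner x z - inner y z.
Proof. by rewrite -scaleN1r innerDl innerZl rmorphN1 mulN1r. Qed.

Lemma inner_suml I (s : seq I) (P : pred I) (F : I -> H) x :
  inner (\sum_(i <- s | P i) F i) x = \sum_(i <- s | P i) inner (F i) x.
Proof.
by rewrite innerC !raddf_sum; apply: eq_bigr => i _ /=; rewrite conj_inner.
Qed.

Lemma inner_ge0 x : 0 <= inner x x.
Proof. by rewrite inner_norm exprn_ge0. Qed.

Lemma inner_eq0 x : inner x x = 0 -> x = 0.
Proof. by rewrite inner_norm => /eqP; rewrite sqrf_eq0 normr_eq0 => /eqP. Qed.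

Lemma inner_projE (E : {linear H -> H}) x :
  self_adjoint E -> (forall y, E (E y) = E y) ->
  inner x (E x) = inner (E x) (E x).
Proof. by move=> E_sa E_idem; rewrite E_sa E_idem. Qed.

(** The difference of the two sides is [<x - E x|x - E x>]. *)
Lemma inner_proj_le (E : {linear H -> H}) x :
  self_adjoint E -> (forall y, E (E y) = E y) -> inner x (E x) <= inner x x.
Proof.
move=> E_sa E_idem; have := inner_ge0 (x - E x).
by rewrite innerBl !linearB /= !E_sa E_idem opprK addNr addr0 subr_ge0.
Qed.

(** The bound [M = 1] comes from [|E x|^2 = <x|E x> <= <x|x> = |x|^2]. *)
Lemma orth_projectionP (E : {linear H -> H}) :
  orth_projection E <-> self_adjoint E /\ forall y, E (E y) = E y.
Proof.
split=> [[]//|[E_sa E_idem]]; split=> //; exists 1 => x.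
rewrite mul1r -(@ler_pXn2r _ 2) ?nnegrE // -!inner_norm -inner_projE //.
exact: inner_proj_le.
Qed.

(** * Gram matrices of linear combinations *)

Definition cross_gram m n (u : 'I_m -> H) (v : 'I_n -> H) : 'M[K]_(m, n) :=
  \matrix_(i, j) inner (u i) (v j).

(** With [u] seen as a row of vectors this is the row [u X], so that combinations compose by matrix
    product. *)
Definition comb m n (u : 'I_m -> H) (X : 'M[K]_(m, n)) (j : 'I_n) : H :=
  \sum_i X i j *: u i.

Lemma cross_gram_comb m n p q (u : 'I_m -> H) (v : 'I_n -> H)
    (X : 'M[K]_(m, p)) (Y : 'M[K]_(n, q)) :
  cross_gram (comb u X) (comb v Y) = ctranspose X *m cross_gram u v *m Y.
Proof.
apply/matrixP => i j; rewrite !mxE /comb raddf_sum; apply: eq_bigr => l _.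
rewrite /= innerZr inner_suml mulrC; congr (_ * _).
by rewrite mxE; apply: eq_bigr => h _; rewrite innerZl !mxE.
Qed.

Lemma comb_comb m n p (u : 'I_m -> H) (X : 'M[K]_(m, n)) (Y : 'M[K]_(n, p)) :
  comb (comb u X) Y =1 comb u (X *m Y).
Proof.
move=> j; rewrite /comb; under eq_bigr do rewrite scaler_sumr.
rewrite exchange_big; apply: eq_bigr => i _; rewrite mxE scaler_suml.
by apply: eq_bigr => l _; rewrite scalerA mulrC.
Qed.

Lemma combB m n (u : 'I_m -> H) (X Y : 'M[K]_(m, n)) j :
  comb u (X - Y) j = comb u X j - comb u Y j.
Proof.
by rewrite /comb -sumrB; apply: eq_bigr => i _; rewrite !mxE scalerBl.
Qed.

Lemma comb1 n (u : 'I_n -> H) : comb u 1%:M =1 u.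
Proof.
move=> j; rewrite /comb (bigD1 j) //= mxE eqxx scale1r big1 ?addr0 // => i.
by move=> /negPf ne_ij; rewrite mxE ne_ij scale0r.
Qed.

Lemma linear_comb (E : {linear H -> H}) m n (u : 'I_m -> H) (X : 'M[K]_(m, n)) :
  E \o comb u X =1 comb (E \o u) X.
Proof.
move=> j; rewrite /= /comb raddf_sum.
by apply: eq_bigr => i _ /=; rewrite linearZ.
Qed.

(** For [X = G S - 1] one has [S X = 0], so the Gram matrix [X^* S^* S X] of the differences
    [u G S - u] vanishes, and each difference with it. *)
Lemma comb_ginv m n (u : 'I_n -> H) (S : 'M[K]_(m, n)) (G : 'M[K]_(n, m)) :
  gram u = ctranspose S *m S -> S *m G *m S = S -> comb (comb u G) S =1 u.
Proof.
move=> gramE SGS j; rewrite comb_comb; apply/eqP; rewrite -subr_eq0; apply/eqP.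
pose X := G *m S - 1%:M.
have -> : comb u (G *m S) j - u j = comb u X j by rewrite combB comb1.
have SX : S *m X = 0 by rewrite mulmxBr mulmxA SGS mulmx1 subrr.
apply: inner_eq0; have /matrixP/(_ j j) := cross_gram_comb u u X X.
by rewrite [cross_gram u u]gramE -!mulmxA SX !mulmx0 !mxE.
Qed.

(** * The weighted sum as a trace, and its diagonalisation *)

Lemma weighted_sumE N (u : 'I_N -> H) (lam : 'I_N -> R) (E : {linear H -> H}) :
  \sum_n lam n * scalar_re (inner (u n) (E (u n))) =
  scalar_re (\tr (real_diag k lam *m cross_gram u (E \o u))).
Proof.
rewrite /mxtrace raddf_sum; apply: eq_bigr => n _.
by rewrite mul_diag_mx !mxE /= scalar_re_realM.
Qed.

Lemma cross_gram_ext m n (u u' : 'I_m -> H) (v v' : 'I_n -> H) :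
  u =1 u' -> v =1 v' -> cross_gram u v = cross_gram u' v'.
Proof. by move=> eq_u eq_v; apply/matrixP => i j; rewrite !mxE eq_u eq_v. Qed.

Lemma mxtrace_sandwich m n (L : 'M[K]_m) (A : 'M[K]_(m, n)) (M : 'M[K]_n)
    (B : 'M[K]_(n, m)) :
  \tr (L *m (A *m M *m B)) = \tr (M *m (B *m L *m A)).
Proof. by rewrite mxtrace_mulC -!mulmxA mxtrace_mulC !mulmxA. Qed.

(** Orthonormality is restricted to nonzero [d i]: an eigenvector in the kernel of [P] may leave the
    range of [S], where its image need not have norm 1. *)
Lemma spectral_reduction N (u : 'I_N -> H) (lam : 'I_N -> R) r
    (S : 'M[K]_(r, N)) (U : 'M[K]_r) (d : 'I_r -> R) :
  gram u = ctranspose S *m S -> U *m ctranspose U = 1%:M ->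
  S *m real_diag k lam *m ctranspose S = ctranspose U *m real_diag k d *m U ->
  exists w : 'I_r -> H,
    (forall i j, d i != 0 -> d j != 0 -> inner (w i) (w j) = (i == j)%:R) /\
    (forall E : {linear H -> H},
       \sum_n lam n * scalar_re (inner (u n) (E (u n))) =
       \sum_i d i * scalar_re (inner (w i) (E (w i)))).
Proof.
move=> gramE UU PE.
have [G SGS] : exists G, S *m G *m S = S by exists (pinvmx S); exact: mulmxKpV.
(* [t i] is the image under [T G = W S G] of the [i]-th basis vector; [S G] is
   the identity on the range of [S], where the eigenvectors lie. *)
pose t := comb u G.
pose w := comb t (ctranspose U); exists w; split=> [i j di_neq0 dj_neq0|E].
  pose D := real_diag k d; pose Y := S *m G *m ctranspose U.
  (* From [P U^* = U^* D], the columns of [U^* D] lie in the range of [S], which [S G] fixes. *)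
  have YD : Y *m D = ctranspose U *m D.
    have UD : ctranspose U *m D =
        S *m (real_diag k lam *m ctranspose S *m ctranspose U).
      by rewrite !mulmxA PE -mulmxA UU mulmx1.
    by rewrite /Y -mulmxA UD !(mulmxA (S *m G)) SGS.
  have gram_w : cross_gram w w = ctranspose Y *m Y.
    rewrite !cross_gram_comb [cross_gram u u]gramE.
    by rewrite /Y !ctranspose_mul !mulmxA.
  (* The factors [D] on both sides make [YD] applicable; entrywise, the nonzero [d i] and [d j] then
     cancel. *)
  have : D *m cross_gram w w *m D = D *m D.
    rewrite gram_w mulmxA -{1}[D]ctranspose_real_diag -ctranspose_mul.
    rewrite -mulmxA YD ctranspose_mul ctransposeK ctranspose_real_diag.
    by rewrite mulmxA -(mulmxA D) UU mulmx1.
  move=> /matrixP/(_ i j); rewrite mul_mx_diag !mul_diag_mx !mxE -mulrA.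
  have real_neq0 l : d l != 0 -> scalar_of_real k (d l) != 0.
    by rewrite fmorph_eq0.
  move=> /(mulfI (real_neq0 _ di_neq0)) dwE.
  apply: (mulIf (real_neq0 _ dj_neq0)); rewrite dwE.
  by case: eqP => [->|_]; rewrite ?mulr1n ?mul1r ?mulr0n ?mul0r.
(* Since [u = t S] and [w = t U^*], cyclicity turns both traces into that of the matrix of
   [<t i|E (t j)>] times [P], written as [S Lambda S^*] on one side and [U^* D U] on the other. *)
rewrite !weighted_sumE.
have uE : comb t S =1 u := comb_ginv gramE SGS.
have EuE : comb (E \o t) S =1 E \o u.
  by move=> n; rewrite -linear_comb /= uE.
have EwE : comb (E \o t) (ctranspose U) =1 E \o w.
  by move=> n; rewrite -linear_comb.
rewrite -(cross_gram_ext uE EuE) -(cross_gram_ext (fun=> erefl) EwE).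
rewrite !cross_gram_comb ctransposeK; congr scalar_re.
by rewrite [LHS]mxtrace_sandwich [RHS]mxtrace_sandwich PE.
Qed.

(** * Projection onto the span of an orthonormal subfamily *)

Lemma orthonormal_projection r (w : 'I_r -> H) (p : pred 'I_r) :
  (forall i j, p i -> p j -> inner (w i) (w j) = (i == j)%:R) ->
  exists2 E : {linear H -> H}, orth_projection E &
    forall x, E x = \sum_(i | p i) inner (w i) x *: w i.
Proof.
move=> w_on; pose f x := \sum_(i | p i) inner (w i) x *: w i.
have f_lin : linear f.
  move=> a x y; rewrite /f scaler_sumr -big_split; apply: eq_bigr => i _ /=.
  by rewrite linearP scalerDl scalerA.
pose f_mixin := GRing.isLinear.Build _ _ _ _ f f_lin.
pose E : {linear H -> H} := HB.pack f f_mixin.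
have EE x : E x = \sum_(i | p i) inner (w i) x *: w i by [].
exists E => //; apply/orth_projectionP; split=> [x y|x].
  rewrite !EE inner_suml raddf_sum; apply: eq_bigr => i _.
  by rewrite /= innerZl innerZr conj_inner mulrC.
rewrite [LHS]EE [RHS]EE; apply: eq_bigr => i pi; congr (_ *: _).
rewrite EE raddf_sum (bigD1 i) //= innerZr w_on // eqxx mulr1 big1 ?addr0 //.
by move=> j /andP[pj ne_ji]; rewrite innerZr w_on // eq_sym (negPf ne_ji) mulr0.
Qed.

End InnerProduct.

(** * The supremum: upper bound and attainment *)

Theorem theorem1 (R : realType) (k : scalar_kind) (H : hilbertType R k)
    (N : nat) (u : 'I_N -> H) (lam : 'I_N -> R)
    (r : nat) (S : 'M[scalar_field R k]_(r, N)) :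
  gram u = ctranspose S *m S ->
  let P := S *m real_diag k lam *m ctranspose S in
  ereal_sup
    [set (\sum_(n < N) lam n * scalar_re (inner (u n) (E (u n))))%:E
      | E in [set E : {linear H -> H} | orth_projection E]]
  = (sum_pos_eigenvalues P)%:E.
Proof.
move=> gramE P; have P_sa : ctranspose P = P.
  by rewrite !ctranspose_mul ctransposeK ctranspose_real_diag mulmxA.
have [U [d [UU PE]]] := spectral_theorem P_sa.
have [w [w_on objE]] := spectral_reduction gramE UU PE.
rewrite PE (sum_pos_eigenvalues_diag _ UU).
apply/eqP; rewrite eq_le; apply/andP; split.
  (* Termwise bound: [<w i|E (w i)>] is nonnegative, which settles [d i <= 0], and at most
     [<w i|w i> = 1] when [d i > 0]. *)
  apply: ge_ereal_sup => _ [E /orth_projectionP[E_sa E_idem] <-].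
  rewrite lee_fin objE [leRHS]big_mkcond; apply: ler_sum => i _ /=.
  case: ltP => [di_gt0|di_le0]; last first.
    rewrite mulr_le0_ge0 // inner_projE //.
    have := le_scalar_re (inner_ge0 (E (w i))); by rewrite raddf0.
  rewrite ler_piMr ?(ltW di_gt0) //.
  have := le_scalar_re (inner_proj_le (w i) E_sa E_idem).
  by rewrite w_on ?eqxx ?scalar_re1 // (gt_eqF di_gt0).
have pos_neq0 i : 0 < d i -> d i != 0 by move=> di_gt0; rewrite gt_eqF.
(* The bound is attained by the projection onto the span of the [w i] with [d i > 0]. *)
have [|E E_proj EE] := @orthonormal_projection _ _ _ _ w (fun i => 0 < d i).
  by move=> i j /pos_neq0 di_neq0 /pos_neq0 dj_neq0; exact: w_on.
apply: ereal_sup_ge; eexists; first by exists E.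
rewrite lee_fin objE [leLHS]big_mkcond; apply: ler_sum => i _ /=.
rewrite EE raddf_sum /=.
(* The case [d i = 0] is split off because nothing is known of [w i] there; for [d i < 0], [w i] is
   orthogonal to the span and its term vanishes. *)
have [->|di_neq0] := eqVneq (d i) 0; first by rewrite ltxx mul0r.
case: ifPn => [di_gt0|di_le0].
  rewrite (bigD1 i) //= innerZr w_on // eqxx mulr1 big1 => [|j].
    by rewrite addr0 scalar_re1 mulr1.
  move=> /andP[/pos_neq0 dj_neq0 ne_ji]; rewrite innerZr w_on //.
  by rewrite (negPf ne_ji) mul0r.
rewrite big1 ?raddf0 ?mulr0 // => j dj_gt0.
rewrite innerZr w_on ?(pos_neq0 j) //.
by case: eqP => [ji|]; [rewrite -ji dj_gt0 in di_le0 | rewrite mul0r].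
Qed.
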